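(* Let $G$ be a finite simple undirected bipartite graph and let $m$ be a nonnegative integer. Then $G$ does not contain more than $m$ pairwise vertex-disjoint $4k$-cycles if and only if, for every even $i\in\{0,2,4,\dots\}$ and every induced subgraph $G_i$ of $G$ on $i$ vertices, \[ \operatorname{per}(G_i)=(-1)^{i/2}\sum_{z=0}^{m}\frac{4^z}{z!}\sum_{T_z}\det(G_i\setminus T_z), \] where, for each $z$, the inner sum runs over all ordered tuples $T_z=(R_1,\dots,R_z)$ of $z$ mutually vertex-disjoint $4k$-cycles of $G_i$.
   Context: For a graph $H$ with vertex set $\{v_1,\dots,v_n\}$, the adjacency matrix $A(H)=(a_{ij})$ is the $n\times n$ matrix with $a_{ij}=1$ if $v_i$ and $v_j$ are adjacent and $0$ otherwise; $\det(H)$ and $\operatorname{per}(H)$ denote the determinant and the permanent $\operatorname{per}(M)=\sum_{\sigma\in S_n}\prod_i a_{i,\sigma(i)}$ of $A(H)$ (for the empty graph both equal $1$). A cycle of length $l$ is a sequence of distinct vertices $u_1,\dots,u_l$ with $u_j\sim u_{j+1}$ for $j<l$ and $u_l\sim u_1$ (considered as a subgraph); a $4k$-cycle is a cycle whose length is a positive multiple of $4$. For a tuple $T_z$ of vertex-disjoint cycles in $H$, $\det(H\setminus T_z)$ is the determinant of the principal submatrix of $A(H)$ obtained by deleting the rows and columns of all vertices lying on the cycles of $T_z$ (empty determinant $=1$). For $z=0$ the only tuple is the empty tuple, so the $z=0$ term is $\det(H)$. *)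

(* Defs.v *)
From HB Require Import structures.
From mathcomp Require Import all_boot all_order all_algebra.
From mathcomp Require Import perm.
Set Implicit Arguments.
Unset Strict Implicit.
Unset Printing Implicit Defensive.
Import GRing.Theory Num.Theory.
Local Open Scope ring_scope.

Definition simple_graph (T : finType) (e : rel T) : Prop :=
  symmetric e /\ irreflexive e.

Definition bipartite (T : finType) (e : rel T) : Prop :=
  exists c : T -> bool, forall x y, e x y -> c x != c y.

Definition cycle_edges (T : finType) (s : seq T) : {set {set T}} :=
  [set:: [seq [set p.1; p.2] | p <- zip s (rot 1 s)]].

(* A 4k-cycle (as a subgraph, identified by its edge set): there is a
   sequence of l distinct vertices, l a positive multiple of 4, with
   consecutive vertices adjacent and the last adjacent to the first.
   Distinctness forces l <= #|T|, so bounding l by #|T| loses nothing. *)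
Definition is_4kcycle (T : finType) (e : rel T) (C : {set {set T}}) : bool :=
  [exists n : 'I_(#|T|).+1, [exists t : n.-tuple T,
     [&& uniq t, 0 < (n : nat), 4 %| n, path.cycle e t & C == cycle_edges t]]]%N.

Definition cverts (T : finType) (C : {set {set T}}) : {set T} :=
  \bigcup_(E in C) E.

Definition disj_4k_family (T : finType) (e : rel T) (S : {set T})
    (s : seq {set {set T}}) : bool :=
  all (fun C => is_4kcycle e C && (cverts C \subset S)) s &&
  pairwise (fun C D => [disjoint cverts C & cverts D]) s.

(* Adjacency matrix of the induced subgraph G[S] (vertices listed in the
   enumeration order of S; det and per are independent of the order). *)
Definition adjmx (T : finType) (e : rel T) (S : {set T}) : 'M[rat]_#|S| :=
  \matrix_(i, j) ((e (enum_val i) (enum_val j) : nat)%:R).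

Definition per (R : comRingType) (n : nat) (A : 'M[R]_n) : R :=
  \sum_(s : 'S_n) \prod_(i < n) A i (s i).

Definition fverts (T : finType) (s : seq {set {set T}}) : {set T} :=
  \bigcup_(C <- s) cverts C.

(* Main.v *)
(* Expanding along the cycle of a permutation through a fixed vertex [x] turns
   [per] and [(-1)^(#|S|/2) det] into recursions over the directed cycles
   through [x]: each cycle has weight [1] for [per], and weight [-1] or [1] for
   the normalized determinant according to whether its length is a multiple of 4
   or not (all lengths are even, the graph being bipartite).  A 4k-cycle has two
   orientations, so the weight [4] given to an undirected 4k-cycle in the sum
   over families amounts to adding [2] to the weight [-1] of each orientation:
   the untruncated sum over families satisfies the recursion of [per], hence
   equals it on every [S].  Truncating at [m] thus loses nothing if no
   [m + 1] cycles are disjoint; conversely, if [S] is the vertex set of [m + 1]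
   disjoint 4k-cycles, with [#|S|] minimal, every family in the discarded tail
   covers [S] and contributes the positive term [4 ^ z]. *)
Require Import Defs.
From HB Require Import structures.
From mathcomp Require Import all_boot all_order all_algebra.
From mathcomp Require Import perm fingroup action.
From mathcomp Require Import ring.
Import GRing.Theory Num.Theory.
Local Open Scope ring_scope.

Set Implicit Arguments.
Unset Strict Implicit.
Unset Printing Implicit Defensive.

(** * Auxiliary facts on indicator products, subsets and orbits of permutations *)

Lemma prod_nat_of_bool (R : comNzRingType) (I : finType) (A : {set I}) (b : pred I) :
  \prod_(i in A) ((b i : nat)%:R : R) = ([forall i in A, b i] : nat)%:R.
Proof.
have [/forall_inP bA|] := boolP [forall i in A, b i].
  by rewrite big1 // => i /bA ->.
rewrite negb_forall_in => /exists_inP[i iA /negbTE nb].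
by rewrite (bigD1 i) //= nb mul0r.
Qed.

Lemma subset_card (I : finType) (A : {set I}) n : (n <= #|A|)%N ->
  exists2 B : {set I}, B \subset A & #|B| = n.
Proof.
move=> nA; exists [set:: take n (enum A)].
  by apply/subsetP=> x; rewrite inE => /mem_take; rewrite mem_enum.
rewrite cardsE (card_uniqP _) ?take_uniq ?enum_uniq //.
by rewrite size_take -cardE; case: ltngtP nA.
Qed.

Lemma porbit_perm1 (T : finType) (s : {perm T}) x y : (s y \in porbit s x) = (y \in porbit s x).
Proof.
have := porbit_perm s 1 y; rewrite expg1 => E.
by rewrite -!eq_porbit_mem E.
Qed.

Lemma eq_in_porbit (T : finType) (s t : {perm T}) x : {in porbit s x, t =1 s} -> porbit t x = porbit s x.
Proof.
move=> ts.
have E i : (t ^+ i)%g x = (s ^+ i)%g x.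
  by rewrite !permX; elim: i => //= i ->; rewrite -permX ts ?mem_porbit.
by apply/setP=> z; apply/porbitP/porbitP=> -[i ->]; exists i; rewrite E.
Qed.

Lemma porbit_sub (T : finType) (S : {set T}) (s : {perm T}) x : perm_on S s -> x \in S -> porbit s x \subset S.
Proof.
move=> sS xS; apply/subsetP=> y /porbitP[i ->]; rewrite permX.
by elim: i => //= i IH; rewrite (perm_closed _ sS).
Qed.

(** * Permutations of the index type ['I_#|S|] as permutations of [T] supported on [S] *)

Section PermExtension.

Variables (T : finType) (S : {set T}).
Implicit Types (s t : 'S_#|S|) (i j : 'I_#|S|) (x : T).

Definition ext_fun s x : T :=
  if [pick i | enum_val i == x] is Some i then enum_val (s i) else x.

Lemma ext_fun_val s i : ext_fun s (enum_val i) = enum_val (s i).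
Proof.
rewrite /ext_fun; case: pickP => [j /eqP/enum_val_inj -> //|/(_ i)].
by rewrite eqxx.
Qed.

Lemma ext_fun_out s x : x \notin S -> ext_fun s x = x.
Proof.
rewrite /ext_fun; case: pickP => [j /eqP <-|//].
by rewrite enum_valP.
Qed.

Lemma enum_val_ex x : x \in S -> exists i : 'I_#|S|, x = enum_val i.
Proof. by move=> xS; exists (enum_rank_in xS x); rewrite enum_rankK_in. Qed.

Lemma ext_funK s : cancel (ext_fun s) (ext_fun s^-1%g).
Proof.
move=> x; have [xS|xS] := boolP (x \in S); last by rewrite !ext_fun_out.
by have [i ->] := enum_val_ex xS; rewrite !ext_fun_val permK.
Qed.

(** Extending by the identity off [S] puts the permutations for all vertex sets into one group,
    where they can be multiplied and restricted. *)
Definition ext_perm s : {perm T} := perm (can_inj (ext_funK s)).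

Lemma ext_perm_val s i : ext_perm s (enum_val i) = enum_val (s i).
Proof. by rewrite permE ext_fun_val. Qed.

Lemma ext_perm_out s x : x \notin S -> ext_perm s x = x.
Proof. by rewrite permE; apply: ext_fun_out. Qed.

Lemma ext_perm_on s : perm_on S (ext_perm s).
Proof.
by apply/subsetP=> x; rewrite inE; apply: contraR => /(ext_perm_out s) ->.
Qed.

Lemma ext_perm_inj : injective ext_perm.
Proof.
move=> s t st; apply/permP=> i; apply: enum_val_inj.
by rewrite -!ext_perm_val st.
Qed.

Lemma ext_permM s t : ext_perm (s * t) = (ext_perm s * ext_perm t)%g.
Proof.
apply/permP=> x; rewrite permM.
have [xS|xS] := boolP (x \in S); last by rewrite !ext_perm_out.
by have [i ->] := enum_val_ex xS; rewrite !ext_perm_val permM.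
Qed.

Lemma ext_perm1 : ext_perm 1%g = 1%g.
Proof. by apply: (mulgI (ext_perm 1%g)); rewrite -ext_permM !mulg1. Qed.

Lemma ext_perm_tperm i j :
  ext_perm (tperm i j) = tperm (enum_val i) (enum_val j).
Proof.
apply/permP=> x; have [xS|xS] := boolP (x \in S).
  have [k ->] := enum_val_ex xS; rewrite ext_perm_val.
  by rewrite (inj_tperm _ _ _ enum_val_inj).
rewrite ext_perm_out // tpermD //; first by apply: contraNneq xS => <-; apply: enum_valP.
by apply: contraNneq xS => <-; apply: enum_valP.
Qed.

(** Extension is a morphism sending transpositions to transpositions, so it preserves a
    factorization into them. *)
Lemma odd_ext_perm s : odd_perm (ext_perm s) = odd_perm s.
Proof.
have [ts -> _] := prod_tpermP s.
elim: ts => [|[i j] ts IH]; first by rewrite big_nil ext_perm1 !odd_perm1.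
rewrite big_cons ext_permM !odd_permM IH /= ext_perm_tperm !odd_tperm.
by rewrite (inj_eq enum_val_inj).
Qed.

(** [ext_perm] is injective and both index sets have the factorial of [#|S|] elements, so it is a
    bijection between them. *)
Lemma big_ext_perm (R : nmodType) (f : {perm T} -> R) :
  \sum_(s : {perm T} | perm_on S s) f s = \sum_(s : 'S_#|S|) f (ext_perm s).
Proof.
have E : [set ext_perm s | s in predT] = [set s : {perm T} | perm_on S s].
  apply/eqP; rewrite eqEcard; apply/andP; split.
    by apply/subsetP=> _ /imsetP[t _ ->]; rewrite inE ext_perm_on.
  by rewrite (card_imset _ ext_perm_inj) card_Sn cardsE card_perm.
rewrite -(big_imset f (A := predT) (in2W ext_perm_inj)) E.
by apply: eq_bigl => s; rewrite inE.
Qed.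

End PermExtension.

(** * Permutations moving along edges: Leibniz expansions and splitting off one cycle *)

Section EdgePerms.

Variables (T : finType) (e : rel T).
Implicit Types (S O : {set T}) (s t c : {perm T}) (x y : T).

(** These index the nonzero terms in the Leibniz expansions of [per] and [\det] of [adjmx e S]. *)
Definition edge_perms S : {set {perm T}} :=
  [set s : {perm T} | perm_on S s && [forall x in S, e x (s x)]].

Lemma edge_permsP S s :
  reflect (perm_on S s /\ (forall x, x \in S -> e x (s x))) (s \in edge_perms S).
Proof. by rewrite inE; apply: (iffP andP) => -[? /forall_inP]. Qed.

Lemma sum_ext_adjmx S (g : {perm T} -> rat) :
  \sum_(s : 'S_#|S|) g (ext_perm s) * \prod_i adjmx e S i (s i) =
  \sum_(s in edge_perms S) g s.
Proof.
under [RHS]eq_bigl do rewrite inE.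
rewrite big_mkcondr big_ext_perm; apply: eq_bigr => s _.
have -> : \prod_i adjmx e S i (s i) = \prod_(x in S) ((e x (ext_perm s x) : nat)%:R).
  by rewrite [RHS]big_enum_val; apply: eq_bigr => i _; rewrite mxE ext_perm_val.
rewrite (prod_nat_of_bool rat S (fun x => e x (ext_perm s x))) /=.
by case: ifP => _; rewrite ?mulr1 ?mulr0.
Qed.

Lemma per_adjmx S : per (adjmx e S) = \sum_(s in edge_perms S) 1.
Proof.
rewrite -(sum_ext_adjmx S (fun=> 1)) /per.
by apply: eq_bigr => s _; rewrite mul1r.
Qed.

Lemma det_adjmx S : \det (adjmx e S) = \sum_(s in edge_perms S) (-1) ^+ s.
Proof.
rewrite -(sum_ext_adjmx S (fun s => (-1) ^+ s)) /determinant.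
by apply: eq_bigr => s _; rewrite odd_ext_perm.
Qed.

(** For nonempty [O], the directed Hamiltonian cycles of the subgraph induced on [O], encoded by
    their successor maps; a single edge counts, as the transposition of its ends. *)
Definition dicycles O : {set {perm T}} :=
  [set c in edge_perms O | [forall y in O, porbit c y == O]].

Lemma dicyclesP O c :
  reflect (c \in edge_perms O /\ (forall y, y \in O -> porbit c y = O))
          (c \in dicycles O).
Proof.
rewrite [c \in dicycles O]inE; apply: (iffP andP) => -[-> cO]; split=> //.
  by move=> y yO; apply/eqP; move/forall_inP: cO => ->.
by apply/forall_inP=> y /cO ->.
Qed.

Lemma edge_perms_porbit S s x : s \in edge_perms S -> x \in S ->
  (restr_perm (porbit s x) s \in dicycles (porbit s x)) &&
  (restr_perm (~: porbit s x) s \in edge_perms (S :\: porbit s x)).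
Proof.
move=> /edge_permsP[sS es] xS; set O := porbit s x.
have OS : O \subset S by apply: porbit_sub.
have sN : s \in 'N(O | 'P)%g.
  by apply/astabsP=> y /=; rewrite /aperm porbit_perm1.
have sN' : s \in 'N(~: O | 'P)%g by rewrite astabsC.
apply/andP; split; last first.
  apply/edge_permsP; split.
    apply/subsetP=> y; rewrite !inE.
    have [yO|yO] := boolP (y \in O).
      by rewrite (out_perm (restr_perm_on _ _)) ?eqxx // inE negbK.
    rewrite restr_permE ?in_setC //= => sy.
    by move/subsetP: sS; apply; rewrite inE.
  move=> y; rewrite inE => /andP[yO yS]; rewrite restr_permE ?in_setC //; exact: es.
apply/dicyclesP; split.
  apply/edge_permsP; split; first exact: restr_perm_on.
  by move=> y yO; rewrite restr_permE //; apply: es; apply: (subsetP OS).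
move=> y yO; have Oy : porbit s y = O by apply/eqP; rewrite eq_porbit_mem.
by rewrite -[RHS]Oy; apply: eq_in_porbit => z; rewrite Oy => zO; rewrite restr_permE.
Qed.

(** A permutation is uniquely the product of its cycle through [x] and a permutation fixing the
    vertex set [O] of that cycle pointwise. *)
Lemma sum_edge_perms (R : nmodType) (f : {perm T} -> R) S x : x \in S ->
  \sum_(s in edge_perms S) f s =
  \sum_(O : {set T} | (x \in O) && (O \subset S))
    \sum_(c in dicycles O) \sum_(t in edge_perms (S :\: O)) f (c * t)%g.
Proof.
move=> xS; pose Q (O : {set T}) := (x \in O) && (O \subset S).
rewrite (partition_big (fun s : {perm T} => porbit s x) Q); last first.
  by move=> s /edge_permsP[sS _]; rewrite /Q porbit_id porbit_sub.
apply: eq_bigr => O /andP[xO OS].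
rewrite pair_big_dep /=.
(* The inverse of the product map restricts a permutation to [O] and to its complement. *)
rewrite (reindex_onto (fun p : {perm T} * {perm T} => (p.1 * p.2)%g)
   (fun s => (restr_perm O s, restr_perm (~: O) s))) /=; last first.
  move=> s /andP[sS /eqP sO]; apply/permP=> y; rewrite permM.
  have sN : s \in 'N(O | 'P)%g.
    by apply/astabsP=> z /=; rewrite /aperm -sO porbit_perm1.
  have sN' : s \in 'N(~: O | 'P)%g by rewrite astabsC.
  have [yO|yO] := boolP (y \in O).
    rewrite (restr_permE sN yO) (out_perm (restr_perm_on _ _)) // inE negbK.
    by rewrite -sO porbit_perm1 sO.
  by rewrite (out_perm (restr_perm_on O _)) // restr_permE // in_setC.
apply: eq_bigl => -[c t] /=; apply/idP/idP.
  move=> /andP[/andP[ctS /eqP ctO] /eqP[cE tE]].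
  by have := edge_perms_porbit ctS xS; rewrite ctO cE tE.
(* Conversely, [c * t] acts as [c] on [O] and as [t] off [O], so its orbit of [x] is [O] and the
   restrictions recover both factors. *)
move=> /andP[/dicyclesP[/edge_permsP[cO ec] Oc] /edge_permsP[tS et]].
have tO y : y \in O -> t y = y by move=> yO; rewrite (out_perm tS) // !inE yO.
have cE y : y \in O -> (c * t)%g y = c y.
  by move=> yO; rewrite permM tO // (perm_closed _ cO).
have tE y : y \notin O -> (c * t)%g y = t y.
  by move=> yO; rewrite permM (out_perm cO).
have tO' y : (t y \in O) = (y \in O).
  have [yO|yO] := boolP (y \in O); first by rewrite tO.
  have [yS|yS] := boolP (y \in S :\: O); last by rewrite (out_perm tS) // (negbTE yO).
  by move: (yS); rewrite -(perm_closed _ tS) inE => /andP[/negbTE].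
have ctN : (c * t)%g \in 'N(O | 'P)%g.
  apply/astabsP=> y /=; rewrite /aperm.
  have [yO|yO] := boolP (y \in O); first by rewrite cE // (perm_closed _ cO).
  by rewrite tE // tO' (negbTE yO).
have ctN' : (c * t)%g \in 'N(~: O | 'P)%g by rewrite astabsC.
apply/andP; split; [apply/andP; split|].
- apply/edge_permsP; split.
    apply: perm_onM; first exact: subset_trans cO OS.
    by apply: subset_trans tS _; apply: subsetDl.
  move=> y yS; have [yO|yO] := boolP (y \in O); first by rewrite cE ?ec.
  by rewrite tE ?et // inE yO.
- by apply/eqP; rewrite -[RHS](Oc x xO); apply: eq_in_porbit => y; rewrite Oc // => /cE.
apply/eqP; congr (_, _); apply/permP=> y.
  have [yO|yO] := boolP (y \in O); first by rewrite restr_permE ?cE.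
  by rewrite (out_perm (restr_perm_on _ _)) ?(out_perm cO).
have [yO|yO] := boolP (y \in O).
  by rewrite (out_perm (restr_perm_on _ _)) ?tO // inE negbK.
by rewrite restr_permE ?tE ?in_setC.
Qed.

(** The orbits of [c] are [O] and the [#|~: O|] singletons outside it; the sign is the parity of
    [#|T|] plus the number of orbits. *)
Lemma odd_dicycle O c : O != set0 -> c \in dicycles O -> odd_perm c = ~~ odd #|O|.
Proof.
move=> /set0Pn[x xO] /dicyclesP[/edge_permsP[cO _] Oc].
have fixP y : y \notin O -> porbit c y = [set y].
  move=> yO; apply/setP=> z; rewrite inE; apply/porbitP/eqP => [[i ->]|->].
    by rewrite permX; elim: i => //= i ->; rewrite (out_perm cO).
  by exists 0%N; rewrite expg0 perm1.
have E : porbits c = O |: [set [set y] | y in ~: O].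
  apply/setP=> B; apply/imsetP/setU1P => [[y _ ->]|[->|/imsetP[y yO ->]]].
  - have [yO|yO] := boolP (y \in O); first by left; apply: Oc.
    by right; apply/imsetP; exists y; rewrite ?inE // fixP.
  - by exists x; rewrite ?Oc.
  by exists y; rewrite ?fixP // -in_setC.
rewrite /odd_perm E cardsU1 card_imset; last exact: set1_inj.
rewrite (_ : (O \notin _) = true); last first.
  by apply/imsetP=> -[y]; rewrite inE => /negP yO Oy; apply: yO; rewrite Oy set11.
by rewrite -(cardsC O) oddD /= oddD /=; case: (odd _); case: (odd _).
Qed.

End EdgePerms.

(** * Directed cycles as permutations versus 4k-cycles as edge sets *)

Section CycleEdges.

Variables (T : finType) (e : rel T).
Hypothesis e_sym : symmetric e.
Implicit Types (O : {set T}) (c d : {perm T}) (x y : T) (C : {set {set T}}).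

(** For a directed cycle [c] on [O], this forgets the orientation. *)
Definition perm_edges O c : {set {set T}} := [set [set y; c y] | y in O].

Lemma cycle_edges_next (s : seq T) : uniq s ->
  cycle_edges s = [set [set y; next s y] | y in s].
Proof.
move=> Us; have E : zip s (rot 1 s) = [seq (y, next s y) | y <- s].
  case: s Us => // x p Us; rewrite rot1_cons.
  (* The default [x] supplies the wrap-around: at the last index [next] reads past the end of [p]
     and gets [x], the last entry of [rcons p x]. *)
  apply: (@eq_from_nth _ (x, x)) => [|i].
    by rewrite size_zip size_rcons size_map minnn.
  rewrite size_zip size_rcons minnn => ip.
  rewrite nth_zip ?size_rcons // (nth_map x) // next_nth mem_nth //.
  by rewrite index_uniq // nth_rcons_default.
rewrite /cycle_edges E; apply/setP=> A; rewrite inE -map_comp.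
by apply/mapP/imsetP => -[y ys ->]; exists y.
Qed.

Lemma cverts_perm_edges O c : perm_on O c -> cverts (perm_edges O c) = O.
Proof.
move=> cO; apply/setP=> y; apply/bigcupP/idP => [[_ /imsetP[z zO ->]]|yO].
  by rewrite !inE => /orP[] /eqP -> //; rewrite (perm_closed _ cO).
by exists [set y; c y]; rewrite ?set21 //; apply/imsetP; exists y.
Qed.

Lemma perm_edgesV O c : perm_on O c -> perm_edges O c^-1 = perm_edges O c.
Proof.
move=> cO; have cVO := perm_onV cO.
apply/setP=> A; apply/imsetP/imsetP => -[y yO ->].
  by exists (c^-1%g y); rewrite ?permKV ?(perm_closed _ cVO) // setUC.
by exists (c y); rewrite ?permK ?(perm_closed _ cO) // setUC.
Qed.

(** The directed cycle is the successor map [next s], a permutation because [prev s] inverts it. *)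
Lemma next_dicycle (s : seq T) : uniq s -> path.cycle e s ->
  exists2 c, c \in dicycles e [set:: s] & cycle_edges s = perm_edges [set:: s] c.
Proof.
move=> Us es; have nE := permE (can_inj (prev_next Us)).
exists (perm (can_inj (prev_next Us))); last first.
  rewrite cycle_edges_next //; apply/setP=> A.
  by apply/imsetP/imsetP => -[y]; rewrite ?inE => ys ->; exists y; rewrite ?inE ?nE.
have nO : perm_on [set:: s] (perm (can_inj (prev_next Us))).
  by apply/subsetP=> y; rewrite !inE nE; apply: contraR => ys; rewrite next_nth (negbTE ys).
apply/dicyclesP; split.
  apply/edge_permsP; split=> // y; rewrite inE => ys; rewrite nE.
  exact: next_cycle es ys.
move=> y; rewrite inE => ys; apply/eqP; rewrite eqEsubset porbit_sub ?inE //=.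
apply/subsetP=> z; rewrite inE -(fconnect_cycle (cycle_next Us) ys) => yz.
apply/porbitP; exists (findex (next s) y z).
by rewrite permX -(eq_iter (f := next s)) ?iter_findex.
Qed.

(** The sequence lists the orbit under [c] of a vertex of [O], in order. *)
Lemma dicycle_seq O c : O != set0 -> c \in dicycles e O ->
  exists s : seq T, [/\ uniq s, path.cycle e s, O = [set:: s]
                      & cycle_edges s = perm_edges O c].
Proof.
move=> /set0Pn[x xO] /dicyclesP[/edge_permsP[cO ec] Oc].
have OE : O = [set:: fingraph.orbit c x].
  apply/setP=> y; rewrite inE -fconnect_orbit -{1}(Oc x xO).
  apply/porbitP/idP => [[i ->]|/iter_findex <-]; last by exists (findex c x y); rewrite permX.
  by rewrite permX fconnect_iter.
have nE y : y \in O -> next (fingraph.orbit c x) y = c y.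
  by rewrite {1}OE inE => /(next_cycle (cycle_orbit (@perm_inj _ c) x))/eqP.
have Ux := fingraph.orbit_uniq c x.
exists (fingraph.orbit c x); split=> //.
  apply: cycle_from_next => // y yx.
  by rewrite nE ?ec // OE inE.
rewrite cycle_edges_next //; apply/setP=> A.
apply/imsetP/imsetP => -[y yO ->]; exists y.
- by rewrite OE inE.
- by rewrite nE // OE inE.
- by move: yO; rewrite {1}OE inE.
- by rewrite nE.
Qed.

Lemma is_4kcycleP C :
  reflect (exists O c, [/\ O != set0, (4 %| #|O|)%N, c \in dicycles e O & C = perm_edges O c])
          (is_4kcycle e C).
Proof.
apply: (iffP existsP) => [[n /existsP[t /and5P[Ut n0 n4 et /eqP ->]]]|].
  have [c cO ->] := next_dicycle Ut et; exists [set:: t], c; split=> //.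
    rewrite -card_gt0 cardsE (card_uniqP Ut) size_tuple //.
  by rewrite cardsE (card_uniqP Ut) size_tuple.
move=> [O [c [O0 O4 cO ->]]]; have [s [Us es OE <-]] := dicycle_seq O0 cO.
have Os : #|O| = size s by rewrite OE cardsE (card_uniqP Us).
have sT : (size s < #|T|.+1)%N by rewrite ltnS -Os max_card.
exists (Ordinal sT); apply/existsP; exists (in_tuple s).
by rewrite Us /= es eqxx -Os card_gt0 O0 O4.
Qed.

(** If [c] swapped [y] and [c y], the orbit of [y] would lie in these two points. *)
Lemma dicycle_sqr_neq O c y : (2 < #|O|)%N -> c \in dicycles e O -> y \in O ->
  c (c y) != y.
Proof.
move=> O2 /dicyclesP[_ Oc] yO; apply: contraTneq O2 => ccy; rewrite -leqNgt.
apply: (@leq_trans #|[set y; c y]|); last by rewrite cards2; case: (_ != _).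
apply/subset_leq_card/subsetP=> z; rewrite -(Oc y yO) => /porbitP[i ->].
rewrite permX; elim: i => [|i] /=; first by rewrite set21.
by rewrite !inE => /orP[] /eqP ->; rewrite ?ccy ?eqxx ?orbT.
Qed.

Lemma dicycleV O c : c \in dicycles e O -> (c^-1)%g \in dicycles e O.
Proof.
move=> /dicyclesP[/edge_permsP[cO ec] Oc]; have cVO := perm_onV cO.
apply/dicyclesP; split=> [|y /Oc <-]; last exact: porbitV.
apply/edge_permsP; split=> // y yO.
by rewrite e_sym -{2}(permKV c y) ec // (perm_closed _ cVO).
Qed.

(** The edge from [y] to [d y] is an edge of [c], and the edges of [c] at [y] lead only to its
    successor and its predecessor. *)
Lemma perm_edges_step O c d y : perm_on O c -> perm_edges O d = perm_edges O c ->
  y \in O -> d y = c y \/ d y = (c^-1)%g y.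
Proof.
move=> cO dc yO; have : [set y; d y] \in perm_edges O c.
  by rewrite -dc; apply/imsetP; exists y.
case/imsetP=> z zO /setP E.
have := E y; rewrite !inE eqxx => /esym/orP[] /eqP yz.
  subst z; have := E (c y); rewrite !inE eqxx orbT => /orP[] /eqP Ey.
    by left; have := E (d y); rewrite !inE eqxx orbT Ey orbb => /esym/eqP.
  by left.
right; have -> : (c^-1)%g y = z by rewrite yz permK.
have := E z; rewrite !inE eqxx => /orP[] /eqP Ez //.
by have := E (d y); rewrite !inE -yz Ez eqxx orbT orbb => /esym/eqP.
Qed.

(* Once the first step agrees, orientation propagates: a disagreement at a
   later vertex would make [d] traverse one edge back and forth. *)
Lemma perm_edges_eq O c d x : (2 < #|O|)%N -> c \in dicycles e O ->
  d \in dicycles e O -> perm_edges O d = perm_edges O c -> x \in O ->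
  d x = c x -> d = c.
Proof.
move=> O2 cO dO dc xO dcx.
have [/edge_permsP[cS _] Oc] := dicyclesP _ _ _ cO.
have [/edge_permsP[dS _] Od] := dicyclesP _ _ _ dO.
have iO i : iter i c x \in O by rewrite -permX -(Oc x xO) mem_porbit.
have E i : d (iter i c x) = c (iter i c x).
  elim: i => //= i IH.
  have [//|] := perm_edges_step cS dc (iO i.+1).
  rewrite /= permK -IH => dd.
  by have := dicycle_sqr_neq O2 dO (iO i); rewrite dd eqxx.
apply/permP=> y; have [yO|yO] := boolP (y \in O).
  by have := yO; rewrite -{1}(Oc x xO) => /porbitP[i ->]; rewrite permX.
by rewrite (out_perm cS) ?(out_perm dS).
Qed.

(** The map [perm_edges O] is two-to-one: over a 4k-cycle lie exactly [c] and its inverse, which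
    differ because [c (c x) != x]. *)
Lemma card_dicycles O : O != set0 -> (4 %| #|O|)%N ->
  #|dicycles e O| = (2 * #|[set C | is_4kcycle e C && (cverts C == O)]|)%N.
Proof.
move=> O0 O4; have O2 : (2 < #|O|)%N.
  by rewrite -card_gt0 in O0; case: #|O| O0 O4 => [|[|[|]]].
have /set0Pn[x xO] := O0.
rewrite -sum1_card (partition_big (perm_edges O)
  (mem [set C | is_4kcycle e C && (cverts C == O)])) /=; last first.
  move=> c cO; rewrite inE; apply/andP; split.
    by apply/is_4kcycleP; exists O, c.
  by have /dicyclesP[/edge_permsP[cS _] _] := cO; rewrite cverts_perm_edges.
rewrite mulnC -sum_nat_const; apply: eq_bigr => C.
rewrite inE => /andP[/is_4kcycleP[O' [c [_ _ cO CE]]] /eqP CO].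
have [/edge_permsP[cS _] _] := dicyclesP _ _ _ cO.
have OO' : O' = O by rewrite -CO CE cverts_perm_edges.
rewrite {}OO' {O'} in cO cS CE.
have [/edge_permsP[cVS _] _] := dicyclesP _ _ _ (dicycleV cO).
rewrite sum1_card (_ : #|_| = #|[set c; (c^-1)%g]|); last first.
  apply: eq_card => d; rewrite !inE -topredE /=; apply/andP/orP.
    move=> [dO /eqP dC]; have dc : perm_edges O d = perm_edges O c by rewrite dC.
    have [dx|dx] := perm_edges_step cS dc xO.
      by left; apply/eqP; apply: (perm_edges_eq O2 cO dO dc xO).
    right; apply/eqP; apply: (perm_edges_eq O2 (dicycleV cO) dO _ xO) => //.
    by rewrite perm_edgesV.
  by case=> /eqP ->; rewrite ?dicycleV ?perm_edgesV // CE eqxx.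
rewrite cards2; case: eqP => // cV; have := dicycle_sqr_neq O2 cO xO.
by rewrite {1}cV permK eqxx.
Qed.

Lemma card_cverts C : is_4kcycle e C -> (4 %| #|cverts C|)%N.
Proof.
case/is_4kcycleP=> O [c [_ O4 /dicyclesP[/edge_permsP[cO _] _] ->]].
by rewrite cverts_perm_edges.
Qed.

Lemma cverts_neq0 C : is_4kcycle e C -> cverts C != set0.
Proof.
case/is_4kcycleP=> O [c [O0 _ /dicyclesP[/edge_permsP[cO _] _] ->]].
by rewrite cverts_perm_edges.
Qed.

(** [c] maps each colour class of [O] injectively into the other, so the two classes have equal
    size. *)
Lemma bipartite_dicycle O c : bipartite e -> c \in dicycles e O -> ~~ odd #|O|.
Proof.
move=> [col colP] /dicyclesP[/edge_permsP[cO ec] _].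
pose A := [set y in O | col y]; pose B := [set y in O | ~~ col y].
have AB : #|A| = #|B|.
  apply/eqP; rewrite eqn_leq -{1}(card_imset A (@perm_inj _ c)).
  rewrite -[X in _ && (X <= _)%N](card_imset B (@perm_inj _ c)).
  apply/andP; split; apply/subset_leq_card/subsetP=> ? /imsetP[y];
    rewrite !inE => /andP[yO cy] ->; rewrite (perm_closed _ cO) yO /=;
    by have := colP _ _ (ec y yO); rewrite ?cy ?(negbTE cy); case: (col _).
have AE : O :&: [set y | col y] = A by apply/setP=> y; rewrite !inE.
have BE : O :\: [set y | col y] = B by apply/setP=> y; rewrite !inE andbC.
by rewrite -(cardsID [set y | col y] O) AE BE AB oddD addbb.
Qed.

End CycleEdges.

(** * Unordered families of disjoint 4k-cycles and their orderings *)

Section DisjointFamilies.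

Variables (T : finType) (e : rel T).
Implicit Types (S O : {set T}) (x y : T) (C D : {set {set T}}).
Implicit Types (F : {set {set {set T}}}).

Definition disj_family S F : bool :=
  [forall C in F, is_4kcycle e C && (cverts C \subset S)] &&
  [forall C in F, forall D in F, (C == D) || [disjoint cverts C & cverts D]].

Definition family_cover F : {set T} := \bigcup_(C in F) cverts C.

Lemma disj_familyP S F :
  reflect [/\ forall C, C \in F -> is_4kcycle e C,
              forall C, C \in F -> cverts C \subset S &
              forall C D, C \in F -> D \in F -> C != D ->
                [disjoint cverts C & cverts D]]
          (disj_family S F).
Proof.
apply: (iffP andP) => [[/forall_inP F4 /forall_inP Fd]|[F4 FS Fd]].
  split=> [C /F4/andP[]//|C /F4/andP[]//|C D CF DF CD].
  by move/forall_inP: (Fd C CF) => /(_ D DF); rewrite (negbTE CD).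
split; first by apply/forall_inP=> C CF; rewrite F4 ?FS.
apply/forall_inP=> C CF; apply/forall_inP=> D DF.
by case: eqVneq => //= CD; apply: Fd.
Qed.

Lemma disj_family_sub S F F' : F' \subset F -> disj_family S F -> disj_family S F'.
Proof.
move=> /subsetP sF /disj_familyP[F4 FS Fd]; apply/disj_familyP.
by split=> [C /sF/F4|C /sF/FS|C D /sF CF /sF DF] //; apply: Fd.
Qed.

Lemma disj_family_sub_cover S F : disj_family S F -> family_cover F \subset S.
Proof. by case/disj_familyP=> _ FS _; apply/bigcupsP. Qed.

Lemma disj_family_cover S S' F :
  disj_family S F -> family_cover F \subset S' -> disj_family S' F.
Proof.
case/disj_familyP=> F4 _ Fd /bigcupsP FS; exact/disj_familyP.
Qed.

(** Serves to exchange the choice of a family with the choice of a set [O] avoiding its cover. *)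
Lemma disj_familyD S O F : O \subset S ->
  disj_family (S :\: O) F = disj_family S F && (O \subset S :\: family_cover F).
Proof.
move=> OS; apply/idP/andP=> [dF|[dF OF]].
  have := disj_family_sub_cover dF; rewrite subsetD => /andP[FS FO].
  rewrite subsetD OS disjoint_sym FO; split=> //.
  exact: disj_family_cover dF FS.
apply: (disj_family_cover dF); rewrite subsetD (disj_family_sub_cover dF) /=.
by move: OF; rewrite subsetD disjoint_sym => /andP[].
Qed.

(** From right to left, [C \notin F] is automatic: [cverts C] is nonempty and cannot lie in
    [S :\: cverts C]. *)
Lemma disj_familyU1 S C F : is_4kcycle e C -> cverts C \subset S ->
  disj_family S (C |: F) && (C \notin F) = disj_family (S :\: cverts C) F.
Proof.
move=> C4 CS; apply/andP/disj_familyP=> [[/disj_familyP[F4 FS Fd] CF]|[F4 FS Fd]].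
  split=> [D DF|D DF|D E DF EF DE].
  - by apply: F4; rewrite setU1r.
  - rewrite subsetD FS ?setU1r //=; apply: Fd; rewrite ?setU11 ?setU1r //.
    by apply: contraNneq CF => <-.
  - by apply: Fd; rewrite ?setU1r.
have CF : C \notin F.
  apply: contra (cverts_neq0 C4) => /FS; rewrite subsetD => /andP[_].
  by rewrite -setI_eq0 setIid.
split=> //; apply/disj_familyP.
have CD D : D \in F -> [disjoint cverts D & cverts C].
  by move/FS; rewrite subsetD => /andP[].
split=> [D /setU1P[->|/F4]|D /setU1P[->|/FS]|D E] //.
  by move/subset_trans; apply; apply: subsetDl.
move=> /setU1P[->|DF] /setU1P[->|EF]; rewrite ?eqxx //.
- by rewrite disjoint_sym CD.
- by rewrite CD.
- exact: Fd.
Qed.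

Lemma family_coverU1 C F : C \notin F ->
  family_cover (C |: F) = cverts C :|: family_cover F.
Proof. by move=> CF; rewrite /family_cover big_setU1. Qed.

Lemma card_family_cover S F : disj_family S F -> (4 %| #|family_cover F|)%N.
Proof.
have [n] := ubnP #|F|; elim: n => // n IH in S F *; rewrite ltnS => Fn dF.
have [->|[C CF]] := set_0Vmem F; first by rewrite /family_cover big_set0 cards0.
have [F4 FS _] := disj_familyP _ _ dF.
have CF' : C \notin F :\ C by rewrite setD11.
have dF' : disj_family (S :\: cverts C) (F :\ C).
  by rewrite -disj_familyU1 ?F4 ?FS // setD1K ?dF.
have := disj_family_sub_cover dF'; rewrite subsetD disjoint_sym => /andP[_ CdF].
rewrite -(setD1K CF) family_coverU1 // cardsU (disjoint_setI0 CdF) cards0 subn0.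
rewrite dvdn_add ?(card_cverts (F4 C CF)) // (IH _ _ _ dF') //.
by move: Fn; rewrite (cardsD1 C) CF.
Qed.

(** Cycles have nonempty vertex sets, so pairwise disjointness forces the entries of [t] to be
    distinct. *)
Lemma disj_4k_familyE S (t : seq {set {set T}}) :
  disj_4k_family e S t = uniq t && disj_family S [set:: t].
Proof.
rewrite /disj_4k_family.
pose r : rel {set {set T}} := fun C D => (C == D) || [disjoint cverts C & cverts D].
have [/allP t4|nt4] := boolP (all _ t); last first.
  apply/esym/negbTE/negP=> /andP[_ /disj_familyP[F4 FS _]].
  case/allPn: nt4 => C Ct; rewrite F4 ?FS ?inE //.
rewrite (@eq_in_pairwise _ (is_4kcycle e) _ [rel C D | (C != D) && r C D]); last first.
- by apply/allP=> C /t4/andP[].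
- move=> C D /cverts_neq0 C0 _ /=; rewrite /r; case: eqVneq => //= <-.
  by rewrite -setI_eq0 setIid (negbTE C0).
rewrite pairwise_relI -uniq_pairwise /=; congr (_ && _).
rewrite pairwise_all2rel; first last.
- by move=> C D; rewrite /r eq_sym disjoint_sym.
- by move=> C; rewrite /r eqxx.
apply/allrelP/disj_familyP => [td|[F4 FS Fd] C D Ct Dt].
  split=> [C|C|C D]; rewrite ?inE; try by case/t4/andP.
  by move=> Ct Dt /negbTE CD; have := td C D Ct Dt; rewrite /r CD.
by rewrite /r; case: eqVneq => //= CD; apply: Fd; rewrite ?inE.
Qed.

(** A family of [z] cycles has [z]! orderings, and [f] sees only the covered set. *)
Lemma sum_disj_4k_family S z (f : {set T} -> rat) :
  \sum_(t : z.-tuple {set {set T}} | disj_4k_family e S t) f (fverts t) =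
  (z`!)%:R * \sum_(F | disj_family S F && (#|F| == z)) f (family_cover F).
Proof.
rewrite (partition_big (fun t : z.-tuple _ => [set:: t])
  (fun F => disj_family S F && (#|F| == z))) /=; last first.
  move=> t; rewrite disj_4k_familyE => /andP[Ut ->].
  by rewrite cardsE (card_uniqP Ut) size_tuple eqxx.
rewrite big_distrr; apply: eq_bigr => F /andP[dF /eqP Fz] /=.
rewrite (eq_bigr (fun=> f (family_cover F))); last first.
  move=> t /andP[_ /eqP <-]; rewrite /fverts bigcup_seq; congr f.
  by apply: eq_bigl => C; rewrite inE.
rewrite sumr_const -[LHS]mulr_natl; congr (_%:R * _).
transitivity #|[set t : z.-tuple _ | all (mem F) t & uniq t]|; last first.
  by rewrite card_uniq_tuples Fz ffactnn.
apply: eq_card => t; rewrite inE -topredE /= disj_4k_familyE.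
have [Ut|] := boolP (uniq t); rewrite ?andbF //= andbT.
apply/andP/allP => [[_ /eqP FE] C Ct|tF]; first by rewrite /= -FE inE.
suff -> : [set:: t] = F by [].
apply/eqP; rewrite eqEcard cardsE (card_uniqP Ut) size_tuple Fz leqnn andbT.
by apply/subsetP=> C; rewrite inE; apply: tF.
Qed.

End DisjointFamilies.

(** * Recursions over the directed cycles through a vertex, and the truncated sum *)

Section Recursion.

Variables (T : finType) (e : rel T).
Hypotheses (e_sym : symmetric e) (e_bip : bipartite e).
Implicit Types (S O : {set T}) (x : T) (C : {set {set T}}).
Implicit Types (F : {set {set {set T}}}).

Definition normal_det S : rat := (-1) ^+ (#|S| %/ 2) * \det (adjmx e S).

(** The right-hand side of the formula without truncation, over unordered families, with the sign
    absorbed into [normal_det]. *)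
Definition family_sum S : rat :=
  \sum_(F | disj_family e S F) 4%:R ^+ #|F| * normal_det (S :\: family_cover F).

Lemma per_rec S x : x \in S -> per (adjmx e S) =
  \sum_(O : {set T} | (x \in O) && (O \subset S))
    #|dicycles e O|%:R * per (adjmx e (S :\: O)).
Proof.
move=> xS; rewrite per_adjmx (sum_edge_perms _ _ xS); apply: eq_bigr => O _.
by rewrite -per_adjmx sumr_const -[LHS]mulr_natl.
Qed.

(** A cycle of even length is an odd permutation, whence the minus sign; half-cardinalities add
    because [#|O|] is even. *)
Lemma normal_det_rec S x : x \in S -> normal_det S =
  \sum_(O : {set T} | (x \in O) && (O \subset S))
    #|dicycles e O|%:R * - (-1) ^+ (#|O| %/ 2) * normal_det (S :\: O).
Proof.
move=> xS; rewrite /normal_det det_adjmx (sum_edge_perms _ _ xS) big_distrr /=.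
apply: eq_bigr => O /andP[xO OS].
have O0 : O != set0 by apply/set0Pn; exists x.
(* Evenness of [#|O|] needs an actual directed cycle on [O]; if there is none, the term vanishes. *)
have [->|[c cO]] := set_0Vmem (dicycles e O).
  by rewrite big_set0 cards0 mulr0 !mul0r.
have Oev := bipartite_dicycle e_bip cO.
rewrite (eq_bigr (fun=> - \det (adjmx e (S :\: O)))); last first.
  move=> d dO; rewrite det_adjmx -sumrN; apply: eq_bigr => t _.
  by rewrite odd_permM signr_addb (odd_dicycle O0 dO) Oev mulN1r.
have -> : (#|S| %/ 2 = #|O| %/ 2 + #|S :\: O| %/ 2)%N.
  by rewrite -(cardsID O S) (setIidPr OS) divnDl // dvdn2.
rewrite sumr_const -[_ *+ _]mulr_natl exprD.
by set a := _ ^+ _; set b := _ ^+ _; ring.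
Qed.

Lemma family_sum_rec S x : x \in S -> family_sum S =
  \sum_(O : {set T} | (x \in O) && (O \subset S))
    #|dicycles e O|%:R * family_sum (S :\: O).
Proof.
(* Families covering [x] will lose their cycle through [x]; for the others, the determinant is
   expanded at [x]. *)
move=> xS; rewrite /family_sum (bigID (fun F => x \in family_cover F)) /=.
have -> : \sum_(F | disj_family e S F && (x \notin family_cover F))
    4%:R ^+ #|F| * normal_det (S :\: family_cover F) =
  \sum_(O : {set T} | (x \in O) && (O \subset S))
    #|dicycles e O|%:R * - (-1) ^+ (#|O| %/ 2) * family_sum (S :\: O).
  under eq_bigr => F /andP[_ xF].
    rewrite (@normal_det_rec _ x) ?inE ?xF // big_distrr /=; over.
  rewrite (exchange_big_dep (fun O => (x \in O) && (O \subset S))) /=; last first.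
    by move=> F O _ /andP[-> /subset_trans]; apply; apply: subsetDl.
  apply: eq_bigr => O /andP[xO OS]; rewrite big_distrr /=.
  apply: eq_big => [F|F _].
    rewrite xO /= disj_familyD //; case: (disj_family e S F) => //=.
    rewrite andbC; case: (boolP (O \subset _)) => //= /subsetP/(_ _ xO).
    by rewrite inE => /andP[].
  by rewrite mulrCA !setDDl setUC.
have -> : \sum_(F | disj_family e S F && (x \in family_cover F))
    4%:R ^+ #|F| * normal_det (S :\: family_cover F) =
  \sum_(O : {set T} | (x \in O) && (O \subset S))
    #|[set C | is_4kcycle e C && (cverts C == O)]|%:R * 4%:R * family_sum (S :\: O).
  (* Exactly one member of a disjoint family passes through [x]; the inner sum names it. *)
  transitivity (\sum_(F | disj_family e S F && (x \in family_cover F))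
    \sum_(C | (C \in F) && (x \in cverts C))
      4%:R ^+ #|F| * normal_det (S :\: family_cover F)).
    apply: eq_bigr => F /andP[/disj_familyP[_ _ Fd] /bigcupP[C CF xC]].
    rewrite (big_pred1 C) // => D /=; apply/andP/eqP=> [[DF xD]|->//].
    apply: contraTeq xD => DC; rewrite (disjointFl (Fd _ _ DF CF DC)) //.
  rewrite (exchange_big_dep (fun C =>
    [&& is_4kcycle e C, x \in cverts C & cverts C \subset S])) /=; last first.
    by move=> F C /andP[/disj_familyP[F4 FS _] _] /andP[CF ->]; rewrite F4 ?FS.
  rewrite (partition_big (@cverts T) (fun O => (x \in O) && (O \subset S))) /=; last first.
    by move=> C /and3P[_ -> ->].
  apply: eq_bigr => O /andP[xO OS].
  rewrite (eq_bigr (fun=> 4%:R * family_sum (S :\: O))); last first.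
    move=> C /andP[/and3P[C4 xC CS] /eqP CO].
    (* The new [F] is the family without [C], so one factor [4] comes out. *)
    rewrite (reindex_onto (fun F => C |: F) (fun F => F :\ C)) /=; last first.
      by move=> F /and3P[_ CF _]; rewrite setD1K.
    rewrite /family_sum big_distrr /=; apply: eq_big => [F|F].
      rewrite -CO -disj_familyU1 // setU11 xC /= andbT -andbA; congr (_ && _).
      have [CF|CF] := boolP (C \in F); last first.
        rewrite setU1K // eqxx andbT; apply/bigcupP; exists C => //; exact: setU11.
      by apply/negbTE/negP=> /andP[_ /eqP/setP/(_ C)]; rewrite CF setD11.
    move=> /andP[_ /eqP FE].
    have CF : C \notin F by rewrite -FE setD11.
    by rewrite cardsU1 CF add1n exprS family_coverU1 // setDDl CO mulrA.
  rewrite sumr_const -[LHS]mulr_natl mulrA; congr (_%:R * _ * _).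
  apply: eq_card => C; rewrite inE -topredE /=.
  by case: (cverts C =P O) => [->|]; rewrite ?andbF ?andbT // xO OS !andbT.
rewrite -big_split /=; apply: eq_bigr => O /andP[xO OS]; rewrite -mulrDl.
congr (_ * _).
have O0 : O != set0 by apply/set0Pn; exists x.
(* If [4] divides [#|O|], N undirected cycles on [O] give 2N directed ones, and 4N - 2N = 2N;
   otherwise no 4k-cycle has vertex set [O]. *)
have [O4|O4] := boolP (4 %| #|O|)%N.
  rewrite card_dicycles //.
  have -> : (#|O| %/ 2 = (#|O| %/ 4).*2)%N.
    by rewrite -{1}(divnK O4) -[4%N]/(2 * 2)%N mulnA mulnK // muln2.
  by rewrite -signr_odd odd_double expr0 natrM; ring.
rewrite (_ : [set C | _] = set0); last first.
  apply/setP=> C; rewrite !inE; apply: contraNF O4 => /andP[C4 /eqP <-].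
  exact: card_cverts C4.
rewrite cards0 !mul0r add0r.
have [->|[c cO]] := set_0Vmem (dicycles e O); first by rewrite cards0 mul0r.
have O2 : (2 %| #|O|)%N by rewrite dvdn2 (bipartite_dicycle e_bip cO).
(* [#|O|] is even but not a multiple of [4], so its half is odd and the weight is [1]. *)
rewrite -signr_odd (_ : odd _ = true) ?expr1 ?opprK ?mulr1 //.
apply: contraNT O4; rewrite -dvdn2 -[X in (4 %| X)%N](divnK O2) => O2'.
exact: dvdn_mul O2' (dvdnn 2).
Qed.

Lemma edge_perms0 : edge_perms e set0 = [set 1%g].
Proof.
apply/setP=> s; rewrite !inE; apply/andP/eqP => [[s0 _]|->].
  by rewrite (perm_on_id s0) ?cards0.
by rewrite perm_on1; split=> //; apply/forall_inP=> x; rewrite inE.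
Qed.

Lemma normal_det0 : normal_det set0 = 1.
Proof.
by rewrite /normal_det det_adjmx edge_perms0 big_set1 odd_perm1 cards0 mul1r.
Qed.

Lemma family_sum0 : family_sum set0 = 1.
Proof.
rewrite /family_sum (big_pred1 set0) => [|F].
  by rewrite cards0 expr0 mul1r set0D normal_det0.
apply/idP/eqP => [/disj_familyP[F4 FS _]|->].
  apply/setP=> C; rewrite in_set0; apply/negP=> CF.
  by have := cverts_neq0 (F4 C CF); rewrite -subset0 FS.
by apply/disj_familyP; split=> [C|C|C D]; rewrite in_set0.
Qed.

Lemma per_family_sum S : per (adjmx e S) = family_sum S.
Proof.
have [n] := ubnP #|S|; elim: n => // n IH in S *; rewrite ltnS => Sn.
have [->|[x xS]] := set_0Vmem S.
  by rewrite per_adjmx edge_perms0 big_set1 family_sum0.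
rewrite (per_rec xS) (family_sum_rec xS); apply: eq_bigr => O /andP[xO _].
congr (_ * _); apply: IH; apply: leq_trans Sn; apply/proper_card/properP.
by split; [apply: subsetDl|exists x; rewrite // inE xO].
Qed.

(** The cover has a multiple of [4] vertices, so deleting it keeps the parity of half the
    cardinality. *)
Lemma normal_detD S F : disj_family e S F ->
  (-1) ^+ (#|S| %/ 2) * \det (adjmx e (S :\: family_cover F)) =
  normal_det (S :\: family_cover F).
Proof.
move=> dF; have FS := disj_family_sub_cover dF.
have F4 := card_family_cover dF.
rewrite -(cardsID (family_cover F) S) (setIidPr FS) divnDl; last first.
  exact: dvdn_trans F4.
have -> : (#|family_cover F| %/ 2 = (#|family_cover F| %/ 4).*2)%N.
  by rewrite -{1}(divnK F4) -[4%N]/(2 * 2)%N mulnA mulnK // muln2.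
by rewrite exprD -[X in X * _ * _]signr_odd odd_double expr0 mul1r.
Qed.

(** Division by [z]! cancels the orderings of each family. *)
Lemma truncated_sumE S n :
  (-1) ^+ (#|S| %/ 2) *
      \sum_(z < n)
        ((4%:R : rat) ^+ z / (z`!)%:R) *
        \sum_(t : z.-tuple {set {set T}} | disj_4k_family e S t)
          \det (adjmx e (S :\: fverts t)) =
  \sum_(F | disj_family e S F && (#|F| < n)%N)
    4%:R ^+ #|F| * normal_det (S :\: family_cover F).
Proof.
have -> : \sum_(F | disj_family e S F && (#|F| < n)%N)
    4%:R ^+ #|F| * normal_det (S :\: family_cover F) =
  \sum_(z < n) \sum_(F | disj_family e S F && (#|F| == z))
    4%:R ^+ z * normal_det (S :\: family_cover F).
  rewrite (exchange_big_dep (fun F => disj_family e S F && (#|F| < n)%N)) /=; last first.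
    by move=> z F _ /andP[-> /eqP ->] /=.
  apply: eq_bigr => F /andP[dF Fn]; rewrite (big_pred1 (Ordinal Fn)) // => z.
  by rewrite dF eq_sym.
rewrite big_distrr; apply: eq_bigr => z _ /=.
rewrite (sum_disj_4k_family e S z (fun A => \det (adjmx e (S :\: A)))).
rewrite [X in _ * X]mulrA divfK ?pnatr_eq0 -?lt0n ?fact_gt0 // mulrCA.
rewrite 2!big_distrr; apply: eq_bigr => F /andP[dF _] /=.
by rewrite normal_detD.
Qed.

Lemma disj_tupleE S n :
  (exists t : n.-tuple {set {set T}}, disj_4k_family e S t) <->
  (exists2 F, disj_family e S F & #|F| == n).
Proof.
split=> [[t]|[F dF /eqP Fn]].
  rewrite disj_4k_familyE => /andP[Ut dF]; exists [set:: t] => //.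
  by rewrite cardsE (card_uniqP Ut) size_tuple.
have sF : size (enum F) == n by rewrite -cardE Fn.
exists (Tuple sF); rewrite disj_4k_familyE enum_uniq /=.
by rewrite (_ : [set:: enum F] = F) //; apply/setP=> C; rewrite inE mem_enum.
Qed.

End Recursion.

(** * The equivalence: exactness of the truncation, and its failure on a minimal cover *)

Theorem theorem2 (T : finType) (e : rel T) (m : nat) :
  simple_graph e -> bipartite e ->
  ((~ exists t : (m.+1).-tuple {set {set T}}, disj_4k_family e setT t) <->
   (forall S : {set T}, ~~ odd #|S| ->
      per (adjmx e S) =
      (-1) ^+ (#|S| %/ 2) *
      \sum_(z < m.+1)
        ((4%:R : rat) ^+ z / (z`!)%:R) *
        \sum_(t : z.-tuple {set {set T}} | disj_4k_family e S t)
          \det (adjmx e (S :\: fverts t)))).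
Proof.
move=> [e_sym _] e_bip; rewrite disj_tupleE.
split=> [no_family S _|formula [F0 dF0 F0m]].
  rewrite per_family_sum // truncated_sumE; apply: eq_bigl => F.
  have [dF|//] := boolP (disj_family e S F); rewrite /= ltnS leqNgt.
  (* A family with more than [m] members would contain one with exactly [m.+1]. *)
  apply/esym/negP=> mF; apply: no_family.
  have [F' sF F'm] := subset_card mF; exists F'; last by apply/eqP.
  exact: disj_family_cover (disj_family_sub sF dF) (subsetT _).
pose P := fun F => disj_family e setT F && (#|F| == m.+1).
have PF0 : P F0 by rewrite /P dF0 F0m.
have [F /andP[dF /eqP Fm] F_min] := arg_minnP (fun F => #|family_cover F|) PF0.
pose S := family_cover F.
have dSF : disj_family e S F by apply: disj_family_cover dF _.
have Sev : ~~ odd #|S|.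
  by rewrite -dvdn2; apply: dvdn_trans (card_family_cover dF).
have := formula S Sev; rewrite per_family_sum // truncated_sumE.
rewrite /family_sum (bigID (fun F : {set {set {set T}}} => #|F| < m.+1)%N) /=.
(* After cancelling the common head, the formula at [S] says that the tail vanishes. *)
move/eqP; rewrite -subr_eq0 addrAC subrr add0r; apply/negP.
(* A discarded [F'] contains [m.+1] disjoint cycles, whose cover is by minimality at least as large
   as [S]. *)
have coverE F' : disj_family e S F' && ~~ (#|F'| < m.+1)%N -> family_cover F' = S.
  case/andP=> dF'; rewrite -leqNgt => /subset_card[F'' sF F''m].
  apply/eqP; rewrite eqEcard (disj_family_sub_cover dF') /=.
  apply: (@leq_trans #|family_cover F''|).
    apply: F_min; rewrite /P F''m eqxx andbT.
    exact: disj_family_cover (disj_family_sub sF dF') (subsetT _).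
  apply/subset_leq_card/bigcupsP=> C /(subsetP sF) CF.
  exact: bigcup_sup CF.
under eq_bigr => F' hF' do rewrite (coverE F' hF') setDv normal_det0 mulr1.
(* Every term is now a power of [4], and the term of [F] itself makes the tail nonempty. *)
rewrite lt0r_neq0 // (bigD1 F) /=; last by rewrite dSF Fm ltnn.
rewrite ltr_wpDr ?exprn_gt0 ?ltr0n //.
by apply: sumr_ge0 => F' _; rewrite exprn_ge0 ?ler0n.
Qed.
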